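(* Let $k\ge1$ and let $\boldsymbol{\omega}=(\omega_1,\ldots,\omega_k)$ be a vector of nonnegative integers. For $\mathbf{n}\in\mathbb{N}^k$ and $\delta\in\mathbb{N}$ let $d(\mathbf{n},\delta,\boldsymbol{\omega})$ be the coefficient of the monomial $h^{\delta}t_1^{n_1-\delta-1}\prod_{i=2}^k t_i^{n_i-1}$ in the polynomial \[ \prod_{i=1}^{k}\frac{(\widehat{t_i}+h)^{n_i}-t_i^{n_i}}{(\widehat{t_i}+h)-t_i},\qquad \widehat{t_i}:=\Big(\sum_{j=1}^{k}\omega_j t_j\Big)-t_i . \] Then, as formal power series in $x_1,\ldots,x_k,y$, \[ \sum_{\mathbf{n}\in\mathbb{N}^k}\sum_{\delta=0}^{\infty} d(\mathbf{n},\delta,\boldsymbol{\omega})\,\mathbf{x}^{\mathbf{n}} y^\delta=\frac{1}{H_{\boldsymbol{\omega}}(\mathbf{x},y)}\prod_{i=1}^k\frac{x_i}{1-x_i}, \] where \[ H_{\boldsymbol{\omega}}(\mathbf{x},y):=-y\,x_1\prod_{i=2}^k(1+x_i)+\prod_{i=1}^k(1+x_i)-\sum_{j=1}^k\omega_jx_j\prod_{i\neq j}(1+x_i). \]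
   Context: $\mathbb{N}$ includes $0$, and $\mathbf{x}^{\mathbf{n}}=x_1^{n_1}\cdots x_k^{n_k}$. The $i$-th factor of the product is the polynomial $\sum_{j=0}^{n_i-1}(\widehat{t_i}+h)^{j}t_i^{n_i-1-j}$ (equal to $0$ if $n_i=0$). A coefficient of a monomial with a negative exponent is understood to be $0$. The number $d(\mathbf n,\delta,\boldsymbol\omega)$ is the factor $d(\mathbf n,\boldsymbol\delta,\boldsymbol\omega)$, with $\boldsymbol\delta=(\delta,0,\ldots,0)$, that appears in the degree formula for generalized Kalman varieties of partially symmetric tensors. *)

(* Defs.v *)
From HB Require Import structures.
From mathcomp Require Import all_boot all_order all_algebra.
From mathcomp Require Import boolp.
From mathcomp.multinomials Require Import mpoly.

Set Implicit Arguments.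
Unset Strict Implicit.
Unset Printing Implicit Defensive.

Import GRing.Theory.
Local Open Scope ring_scope.

(* R[[X_0, ..., X_(n-1)]], given by coefficients indexed by the exponents. *)
Record mpseries (n : nat) (R : Type) :=
  MPSeries { mpscoeff :> 'X_{1..n} -> R }.

HB.instance Definition _ (n : nat) (R : Type) := gen_eqMixin (mpseries n R).
HB.instance Definition _ (n : nat) (R : Type) := gen_choiceMixin (mpseries n R).

Lemma mpseriesP (n : nat) (R : Type) (f g : mpseries n R) :
  (forall m, f m = g m) <-> f = g.
Proof.
split=> [|-> //]; case: f g => [f] [g] /= fg.
by congr MPSeries; apply: funext.
Qed.

Section ZmodStructure.
Variables (n : nat) (R : comNzRingType).
Implicit Types f g : mpseries n R.

Definition mps0 : mpseries n R := MPSeries (fun=> 0).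
Definition mps_opp f : mpseries n R := MPSeries (fun m => - f m).
Definition mps_add f g : mpseries n R := MPSeries (fun m => f m + g m).

Fact mps_addA : associative mps_add.
Proof. by move=> f g h; apply/mpseriesP => m /=; rewrite addrA. Qed.
Fact mps_addC : commutative mps_add.
Proof. by move=> f g; apply/mpseriesP => m /=; rewrite addrC. Qed.
Fact mps_add0 : left_id mps0 mps_add.
Proof. by move=> f; apply/mpseriesP => m /=; rewrite add0r. Qed.
Fact mps_addN : left_inverse mps0 mps_opp mps_add.
Proof. by move=> f; apply/mpseriesP => m /=; rewrite addNr. Qed.

HB.instance Definition _ := GRing.isZmodule.Build (mpseries n R)
  mps_addA mps_addC mps_add0 mps_addN.

Lemma mps0E m : (0 : mpseries n R) m = 0. Proof. by []. Qed.
Lemma mpsDE f g m : (f + g) m = f m + g m. Proof. by []. Qed.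
Lemma mpsNE f m : (- f) m = - f m. Proof. by []. Qed.
Lemma mpsBE f g m : (f - g) m = f m - g m. Proof. by []. Qed.

Lemma mps_sumE I (r : seq I) (P : pred I) (F : I -> mpseries n R) m :
  (\sum_(i <- r | P i) F i) m = \sum_(i <- r | P i) F i m.
Proof. by elim/big_rec2: _ => // i x y _ <-. Qed.

End ZmodStructure.

#[global] Arguments mps_opp : simpl never.
#[global] Arguments mps_add : simpl never.

Section RingStructure.
Variables (n : nat) (R : comNzRingType).
Implicit Types (f g h : mpseries n R) (p q : {mpoly R[n]}) (m : 'X_{1..n}).

Definition mpsC (c : R) : mpseries n R :=
  MPSeries (fun m => c *+ (m == 0%MM)).

Definition mpsX (i : 'I_n) : mpseries n R :=
  MPSeries (fun m => (m == U_(i)%MM)%:R).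

(* The sum over all decompositions m = k.1 + k.2; the degree bounds, which
   they satisfy automatically, only make the index type finite. *)
Definition mps_mul f g : mpseries n R :=
  MPSeries (fun m =>
    \sum_(k : 'X_{1..n < (mdeg m).+1, (mdeg m).+1} | m == (k.1 + k.2)%MM)
      f k.1 * g k.2).

Fact mdeg_split m m1 m2 : m = (m1 + m2)%MM ->
  (mdeg m1 <= mdeg m)%N /\ (mdeg m2 <= mdeg m)%N.
Proof. by move->; rewrite mdegD leq_addr leq_addl. Qed.

(* f and p have the same coefficients in degree at most d. *)
Let agree d f p := forall m, (mdeg m <= d)%N -> f m = p@_m.

Let trunc d f : {mpoly R[n]} := \sum_(m : 'X_{1..n < d.+1}) f m *: 'X_[m].

Fact agree_trunc d f : agree d f (trunc d f).
Proof. by move=> m le_md; rewrite /trunc mcoeff_mpoly. Qed.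

Fact agree_mul d f g p q :
  agree d f p -> agree d g q -> agree d (mps_mul f g) (p * q).
Proof.
move=> fp gq m le_md; rewrite mcoeffM /=.
apply: eq_bigr => -[k l] /= /eqP def_m.
have [le_k le_l] := mdeg_split def_m.
by rewrite fp ?gq ?(leq_trans _ le_md).
Qed.

Fact agree_eq d f g p : agree d f p -> agree d g p ->
  forall m, (mdeg m <= d)%N -> f m = g m.
Proof. by move=> fp gp m le_md; rewrite fp // gp. Qed.

Fact agree1 d : agree d (mpsC 1) 1.
Proof. by move=> m _; rewrite mcoeff1. Qed.

Fact mps_mulA : associative mps_mul.
Proof.
move=> f g h; apply/mpseriesP => m; set d := mdeg m.
have F := @agree_trunc d f; have G := @agree_trunc d g.
have H := @agree_trunc d h.
apply: (agree_eq (agree_mul F (agree_mul G H)) _ (leqnn d)).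
by rewrite mulrA; apply: agree_mul => //; apply: agree_mul.
Qed.

Fact mps_mulC : commutative mps_mul.
Proof.
move=> f g; apply/mpseriesP => m; set d := mdeg m.
have F := @agree_trunc d f; have G := @agree_trunc d g.
apply: (agree_eq (agree_mul F G) _ (leqnn d)).
by rewrite mulrC; apply: agree_mul.
Qed.

Fact mps_mul1 : left_id (mpsC 1) mps_mul.
Proof.
move=> f; apply/mpseriesP => m; set d := mdeg m.
apply: (agree_eq (agree_mul (@agree1 d) (@agree_trunc d f)) _ (leqnn d)).
by rewrite mul1r; apply: agree_trunc.
Qed.

Fact mps_mulDl : left_distributive mps_mul +%R.
Proof.
move=> f g h; apply/mpseriesP => m; rewrite mpsDE /= -big_split /=.
by apply: eq_bigr => k _; rewrite mulrDl.
Qed.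

Fact mps_oner_neq0 : mpsC 1 != 0.
Proof.
by apply/eqP => /mpseriesP/(_ 0%MM)/eqP; rewrite /= eqxx oner_eq0.
Qed.

HB.instance Definition _ := GRing.Zmodule_isComNzRing.Build (mpseries n R)
  mps_mulA mps_mulC mps_mul1 mps_mulDl mps_oner_neq0.

Lemma mps1E m : (1 : mpseries n R) m = (m == 0%MM)%:R. Proof. by []. Qed.

Lemma mpsME f g m : (f * g) m =
  \sum_(k : 'X_{1..n < (mdeg m).+1, (mdeg m).+1} | m == (k.1 + k.2)%MM)
    f k.1 * g k.2.
Proof. by []. Qed.

Lemma mpsM0 f g : (f * g) 0%MM = f 0%MM * g 0%MM.
Proof.
have aC h : agree 0 h (h 0%MM)%:MP.
  by move=> m; rewrite leqn0 mdeg_eq0 => /eqP->; rewrite mcoeffC eqxx mulr1.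
have := agree_mul (aC f) (aC g); rewrite /agree => /(_ 0%MM).
by rewrite mdeg0 -mpolyCM mcoeffC eqxx mulr1 => <-.
Qed.

Lemma mpsCM_coef c f m : (mpsC c * f) m = c * f m.
Proof.
have aC : agree (mdeg m) (mpsC c) c%:MP.
  by move=> k _; rewrite mcoeffC mulr_natr.
have aF := @agree_trunc (mdeg m) f.
rewrite [LHS](agree_mul aC aF) //.
by rewrite mcoeffCM -aF.
Qed.

(* The product only sees the coefficients of degree at most mdeg m. *)
Lemma eq_mpsM f f' g g' m :
  (forall k, (mdeg k <= mdeg m)%N -> f k = f' k) ->
  (forall k, (mdeg k <= mdeg m)%N -> g k = g' k) ->
  (f * g) m = (f' * g') m.
Proof.
move=> ff' gg'; rewrite !mpsME; apply: eq_bigr => -[k l] /= /eqP def_m.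
by have [le_k le_l] := mdeg_split def_m; rewrite ff' ?gg'.
Qed.

Lemma mpsX_expr_coef f j m : f 0%MM = 0 -> (mdeg m < j)%N -> (f ^+ j) m = 0.
Proof.
move=> f0; elim: j m => // j IHj m lt_mj; rewrite exprS mpsME big1 // => -[k l] /=.
move/eqP=> def_m.
have dm : mdeg m = (mdeg k + mdeg l)%N by rewrite [in LHS]def_m mdegD.
have [k0|k_gt0] := posnP (mdeg k).
  by move/eqP: k0; rewrite mdeg_eq0 => /eqP->; rewrite f0 mul0r.
rewrite [X in _ * X]IHj ?mulr0 //; rewrite -ltnS; apply: leq_ltn_trans lt_mj.
by rewrite [leqRHS]dm -[leqLHS]add1n leq_add2r.
Qed.

End RingStructure.

#[global] Arguments mps_mul : simpl never.

Section UnitStructure.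
Variables (n : nat) (R : comUnitRingType).
Implicit Types (f g : mpseries n R) (m : 'X_{1..n}).

Definition mps_unit : {pred mpseries n R} :=
  [pred f : mpseries n R | f 0%MM \is a GRing.unit].

(* With f = c (1 - g) and c the constant coefficient of f, the inverse of f is
   the geometric series c^-1 (1 + g + g^2 + ...); only the powers g^j with
   j <= mdeg m contribute to its m-th coefficient. *)
Definition mps_inv f : mpseries n R :=
  if f \in mps_unit then
    MPSeries (fun m => (f 0%MM)^-1 *
      \sum_(j < (mdeg m).+1) ((1 - mpsC n (f 0%MM)^-1 * f) ^+ j) m)
  else f.

Fact mps_mulVx : {in mps_unit, left_inverse 1 mps_inv *%R}.
Proof.
move=> f Uf; apply/mpseriesP => m; rewrite /mps_inv Uf.
set c := f 0%MM; set g := 1 - _; pose d := (mdeg m).+1.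
have Uc : c \is a GRing.unit by [].
have g0 : g 0%MM = 0 by rewrite mpsBE (mpsCM_coef c^-1) mps1E eqxx mulVr ?subrr.
pose s : mpseries n R := mpsC n c^-1 * \sum_(j < d) g ^+ j.
have sE k : s k = c^-1 * \sum_(j < d) (g ^+ j) k.
  by rewrite /s (mpsCM_coef c^-1) mps_sumE.
transitivity ((s * f) m).
  apply: eq_mpsM => // k le_km; rewrite sE /=; congr (_ * _).
  rewrite (big_ord_widen_cond d predT (fun j => (g ^+ j) k)) //=.
  rewrite big_mkcond /=; apply: eq_bigr => j _.
  by case: ltnP => // lt_kj; rewrite mpsX_expr_coef.
have -> : s * f = 1 - g ^+ d.
  rewrite -(expr1n _ d) subrXX mulrC /s mulrA [f * _]mulrC; congr (_ * _).
    by rewrite /g opprB addrCA subrr addr0.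
  by apply: eq_bigr => j _; rewrite expr1n mul1r.
by rewrite mpsBE mpsX_expr_coef ?subr0.
Qed.

Fact mps_unitPl f g : g * f = 1 -> mps_unit f.
Proof.
move=> gf1; apply/unitrPr; exists (g 0%MM).
by rewrite mulrC -mpsM0 gf1 mps1E eqxx.
Qed.

Fact mps_inv_out : {in [predC mps_unit], mps_inv =1 id}.
Proof. by move=> f; rewrite inE /= /mps_inv => /negbTE->. Qed.

HB.instance Definition _ := GRing.ComNzRing_hasMulInverse.Build (mpseries n R)
  mps_mulVx mps_unitPl mps_inv_out.

Lemma mps_unitE f : (f \is a GRing.unit) = (f 0%MM \is a GRing.unit).
Proof. by []. Qed.

End UnitStructure.

#[global] Arguments mps_inv : simpl never.

(* The k >= 1 indices 1, ..., k are represented by 'I_k with k := k'.+1, so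
   that ord0 is the first one.  Among the k.+1 variables of the polynomials
   below, ord0 stands for h and [lift ord0 i] for t_i; among those of the
   power series, ord0 stands for y and [lift ord0 i] for x_i. *)

Section DegreeFactor.
Variable k' : nat.
Notation k := k'.+1.
Implicit Types (n omega : 'I_k -> nat) (i : 'I_k) (delta : nat).

Definition poly_h : {mpoly int[k.+1]} := 'X_ord0.
Definition poly_t i : {mpoly int[k.+1]} := 'X_(lift ord0 i).

Definition t_hat omega i : {mpoly int[k.+1]} :=
  (\sum_j (omega j)%:R * poly_t j) - poly_t i.

Definition t_factor n omega i : {mpoly int[k.+1]} :=
  \sum_(0 <= j < n i)
    (t_hat omega i + poly_h) ^+ j * poly_t i ^+ (n i - 1 - j).

Lemma t_factorP n omega i :
  t_factor n omega i * (t_hat omega i + poly_h - poly_t i) =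
  (t_hat omega i + poly_h) ^+ n i - poly_t i ^+ n i.
Proof.
rewrite -[RHS]opprB subrXX -mulNr opprB mulrC /t_factor big_mkord.
by congr (_ * _); apply: eq_bigr => j _; rewrite mulrC subn1.
Qed.

(* Exponent of h^delta t_1^(n_1-delta-1) \prod_(i >= 2) t_i^(n_i-1); only
   meaningful if the truncated subtractions are genuine ones. *)
Definition dmonomial n delta : 'X_{1..k.+1} :=
  (U_(ord0) *+ delta + U_(lift ord0 ord0) *+ (n ord0 - delta - 1)
   + \sum_(i | i != ord0) U_(lift ord0 i) *+ (n i - 1))%MM.

Definition dcoef n delta omega : int :=
  if (delta + 1 <= n ord0)%N && [forall (i | i != ord0), 1 <= n i]%N
  then (\prod_i t_factor n omega i)@_(dmonomial n delta)
  else 0.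

Definition ser_y : mpseries k.+1 int := mpsX int ord0.
Definition ser_x i : mpseries k.+1 int := mpsX int (lift ord0 i).

(* \sum_(n, delta) d(n, delta, omega) x^n y^delta: an exponent m stands for
   the monomial x^n y^delta with n_i = m (lift ord0 i) and delta = m ord0. *)
Definition dseries omega : mpseries k.+1 int :=
  MPSeries (fun m : 'X_{1..k.+1} =>
    dcoef (fun i => m (lift ord0 i)) (m ord0) omega).

Definition Hser omega : mpseries k.+1 int :=
  - (ser_y * ser_x ord0 * \prod_(i | i != ord0) (1 + ser_x i))
  + \prod_i (1 + ser_x i)
  - \sum_j (omega j)%:R * ser_x j * \prod_(i | i != j) (1 + ser_x i).

Lemma ser_x0 i : ser_x i 0%MM = 0.
Proof. by rewrite /= eq_sym mnm1_eq0. Qed.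

Lemma onem_ser_x_unit i : 1 - ser_x i \is a GRing.unit.
Proof. by rewrite mps_unitE mpsBE ser_x0 subr0 mps1E eqxx unitr1. Qed.

Lemma Hser0 omega : Hser omega 0%MM = 1.
Proof.
have prod1 (P : pred 'I_k) : (\prod_(i | P i) (1 + ser_x i)) 0%MM = 1.
  apply: (big_ind (fun f : mpseries k.+1 int => f 0%MM = 1)) => [|f g|i _].
  - by rewrite mps1E eqxx.
  - by rewrite mpsM0 => -> ->; rewrite mulr1.
  - by rewrite mpsDE ser_x0 addr0 mps1E eqxx.
rewrite /Hser !mpsDE !mpsNE mps_sumE !mpsM0 ser_x0 mulr0 mul0r !prod1.
rewrite oppr0 add0r big1 ?subr0 // => j _.
by rewrite !mpsM0 ser_x0 mulr0 mul0r.
Qed.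

Lemma Hser_unit omega : Hser omega \is a GRing.unit.
Proof. by rewrite mps_unitE Hser0 unitr1. Qed.

End DegreeFactor.

(* Main.v *)
(* Write U = 1 + h + sum_j omega_j t_j, and let [P] denote the series whose
   coefficient at x^n y^delta is that of h^delta t_1^(n_1-delta)
   prod_(i >= 2) t_i^(n_i) in P prod_i (U - t_i)^(n_i).  Shifting exponents
   gives [t_i P] = x_i [(U - t_i) P] and [h P] = y [t_1 P].  For P = V := U^-1
   the first relation reads (1 + x_i) [t_i V] = x_i [1], so expanding
   [1] = [U V] yields H [1] = prod_i (1 + x_i) [V].  The right-hand side is 1:
   (1 + x_i) [V] has no monomial divisible by x_i, since there U V = 1 leaves
   the coefficient of a polynomial of too small a degree.  Hence [1] = 1 / H.
   The summand 1 of U, which makes U invertible, does not affect [1], as only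
   the coefficients of top degree enter.  Finally, one variable at a time,
   multiplication by 1 - x_i turns the geometric sum
   sum_(j <= n_i) (U - 1 - t_i)^j t_i^(n_i-j) into (U - 1 - t_i)^(n_i). *)

Require Import Defs.
From HB Require Import structures.
From mathcomp Require Import all_boot all_order all_algebra.
From mathcomp Require Import ring zify.
From mathcomp.multinomials Require Import mpoly.
Set Implicit Arguments.
Unset Strict Implicit.
Unset Printing Implicit Defensive.
Import GRing.Theory.
Local Open Scope ring_scope.

(** * Coefficients, degree bounds and top-degree parts of power series *)

Section Coefficients.
Variables (n : nat) (R : comNzRingType).
Implicit Types (f g : mpseries n R) (m : 'X_{1..n}).

Definition mps_of_mpoly (p : {mpoly R[n]}) : mpseries n R :=
  MPSeries (fun m => p@_m).

Fact mps_of_mpoly_is_additive : zmod_morphism mps_of_mpoly.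
Proof. by move=> p q; apply/mpseriesP => m /=; rewrite mcoeffB. Qed.

Fact mps_of_mpoly_is_multiplicative : monoid_morphism mps_of_mpoly.
Proof.
split=> [|p q]; apply/mpseriesP => m; first by rewrite /= mcoeff1.
by rewrite mpsME /= mcoeffM.
Qed.

HB.instance Definition _ := GRing.isZmodMorphism.Build _ _ mps_of_mpoly
  mps_of_mpoly_is_additive.
HB.instance Definition _ := GRing.isMonoidMorphism.Build _ _ mps_of_mpoly
  mps_of_mpoly_is_multiplicative.

Lemma mps_of_mpolyX i : mps_of_mpoly 'X_i = mpsX R i.
Proof. by apply/mpseriesP => m; rewrite /= mcoeffX eq_sym. Qed.

Lemma mpsXmM_coef (u : 'X_{1..n}) f m :
  (mps_of_mpoly 'X_[u] * f) m = if (u <= m)%MM then f (m - u)%MM else 0.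
Proof.
rewrite (agree_mul (p := 'X_[u]) _ (@agree_trunc _ _ (mdeg m) f) (leqnn _)) //.
case: ifPn => [le_um|]; last first.
  move=> nle_um; rewrite mcoeffM big1 // => k /eqP mE; rewrite mcoeffX.
  case: eqP => [kE|_]; last by rewrite mul0r.
  case/mnm_lepP: nle_um => i; move/mnmP/(_ i): mE => ->.
  by rewrite kE mnmDE leq_addr.
have shift (q : {mpoly R[n]}) : ('X_[u] * q)@_m = q@_(m - u).
  by rewrite -[in LHS](submK le_um) addmC mulrC mcoeffMX.
by rewrite shift -(@agree_trunc _ _ (mdeg m) f) ?mdegB.
Qed.

Lemma mpsXM_coef (i : 'I_n) f m :
  (mpsX R i * f) m = if (0 < m i)%N then f (m - U_(i))%MM else 0.
Proof. by rewrite -mps_of_mpolyX mpsXmM_coef lep1mP lt0n. Qed.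

Lemma mps_vanish_1DX (Z : pred 'X_{1..n}) (i : 'I_n) f :
  (forall m, Z m -> Z (m - U_(i))%MM) -> (forall m, Z m -> f m = 0) ->
  forall m, Z m -> ((1 + mpsX R i) * f) m = 0.
Proof.
move=> ZB f0 m Zm; rewrite mulrDl mul1r mpsDE mpsXM_coef f0 // add0r.
by case: ifP => // _; rewrite f0 ?ZB.
Qed.

(** The bound is strict so that d = 0 forces f = 0, as equality of top parts in degree 0
    requires. *)
Definition mps_lt d f := forall m, (d <= mdeg m)%N -> f m = 0.

Lemma mps_lt0 d : mps_lt d 0. Proof. by []. Qed.

Lemma mps_lt_le d d' f : (d <= d')%N -> mps_lt d f -> mps_lt d' f.
Proof. by move=> dd' fd m /(leq_trans dd')/fd. Qed.

Lemma mps_ltD d f g : mps_lt d f -> mps_lt d g -> mps_lt d (f + g).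
Proof. by move=> fd gd m le_dm; rewrite mpsDE fd ?gd ?addr0. Qed.

Lemma mps_ltN d f : mps_lt d f -> mps_lt d (- f).
Proof. by move=> fd m le_dm; rewrite mpsNE fd ?oppr0. Qed.

Lemma mps_ltMn d f c : mps_lt d f -> mps_lt d (f *+ c).
Proof.
move=> fd; elim: c => [|c IHc]; first exact: mps_lt0.
by rewrite mulrS; apply: mps_ltD.
Qed.

Lemma mps_ltM d d' f g :
  mps_lt d f -> mps_lt d'.+1 g -> mps_lt (d + d') (f * g).
Proof.
move=> fd gd m le_dm; rewrite mpsME big1 // => -[k l] /= /eqP mE.
have dm := congr1 (@mdeg n) mE; rewrite mdegD in dm.
have [le_dk|lt_kd] := leqP d (mdeg k); first by rewrite fd ?mul0r.
by rewrite [g _]gd ?mulr0 //; lia.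
Qed.

Lemma mps_ltX i : mps_lt 2 (mpsX R i).
Proof.
by move=> m lt1m; rewrite /=; case: eqP lt1m => // ->; rewrite mdeg1.
Qed.

Lemma mps_lt1 : mps_lt 1 1.
Proof. by move=> m; rewrite mps1E; case: eqP => // ->; rewrite mdeg0. Qed.

(* f and g have degree at most d and the same homogeneous part of degree d. *)
Definition mps_top d f g :=
  [/\ mps_lt d.+1 f, mps_lt d.+1 g & mps_lt d (f - g)].

Lemma mps_topM d d' f g f' g' :
  mps_top d f g -> mps_top d' f' g' -> mps_top (d + d') (f * f') (g * g').
Proof.
move=> [fd gd fg] [fd' gd' fg']; split.
- by rewrite -addSn; apply: mps_ltM.
- by rewrite -addSn; apply: mps_ltM.
have -> : f * f' - g * g' = (f - g) * f' + (f' - g') * g by ring.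
by apply: mps_ltD; first exact: mps_ltM; rewrite addnC; apply: mps_ltM.
Qed.

Lemma mps_top1 : mps_top 0 1 1.
Proof. by split; [exact: mps_lt1 | exact: mps_lt1 | rewrite subrr]. Qed.

Lemma mps_topX d f g : mps_top 1 f g -> mps_top d (f ^+ d) (g ^+ d).
Proof.
move=> fg; elim: d => [|d IHd]; first exact: mps_top1.
by rewrite !exprS -add1n; apply: mps_topM.
Qed.

Lemma mps_top_prod (I : finType) (d : I -> nat) (F G : I -> mpseries n R) :
  (forall i, mps_top (d i) (F i) (G i)) ->
  mps_top (\sum_i d i) (\prod_i F i) (\prod_i G i).
Proof.
move=> FG; elim/big_rec3: _ => [|i e f g _ IH]; first exact: mps_top1.
exact: mps_topM.
Qed.

Lemma mps_top_coef f g m : mps_top (mdeg m) f g -> f m = g m.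
Proof. by case=> _ _ /(_ m (leqnn _))/eqP; rewrite mpsBE subr_eq0 => /eqP. Qed.

End Coefficients.

(** * Reading off one coefficient from each member of a family of series *)

Section Diagonal.
Variable k' : nat.
Local Notation k := k'.+1.
Local Notation N := k.+1.
Local Notation ti i := (lift ord0 i : 'I_N).
Implicit Types (B : 'X_{1..N} -> mpseries N int) (m : 'X_{1..N}) (i j : 'I_k).

Definition diag_exp m := (m - U_(ti ord0) *+ m ord0)%MM.

(* The variables of [B m] are h, t_1, ..., t_k, and those of [diag B] are
   y, x_1, ..., x_k: [ser_x i] is t_i inside [diag] and x_i outside. *)
Definition diag B : mpseries N int :=
  MPSeries (fun m =>
    if (m ord0 <= m (ti ord0))%N then B m (diag_exp m) else 0).

Lemma diagE B m :
  diag B m = if (m ord0 <= m (ti ord0))%N then B m (diag_exp m) else 0.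
Proof. by []. Qed.

Lemma diag_expE m j :
  diag_exp m (ti j) = (m (ti j) - (j == ord0) * m ord0)%N.
Proof. by rewrite mnmBE mulmnE mnm1E (inj_eq lift_inj) eq_sym. Qed.

Lemma diag_exp0 m : diag_exp m ord0 = m ord0.
Proof. by rewrite mnmBE mulmnE mnm1E mul0n subn0. Qed.

(** The delta taken from t_1 goes to h, so the total degree is n_1 + ... + n_k, the number of linear
    factors in the products read by [diag]. *)
Lemma mdeg_diag_exp m : (m ord0 <= m (ti ord0))%N ->
  mdeg (diag_exp m) = (\sum_i m (ti i))%N.
Proof.
move=> le_m; have /submK/(congr1 (@mdeg N)) : (U_(ti ord0) *+ m ord0 <= m)%MM.
  apply/mnm_lepP => j; rewrite mulmnE mnm1E; case: eqP => [<-|//].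
  by rewrite mul1n.
rewrite mdegD mdegMn mdeg1 mul1n [RHS]mdegE big_ord_recl addnC.
exact: addnI.
Qed.

Lemma diagXM i B :
  ser_x i * diag B = diag (fun m => ser_x i * B (m - U_(ti i))%MM).
Proof.
apply/mpseriesP => m; rewrite mpsXM_coef !diagE mpsXM_coef diag_expE.
have -> : diag_exp (m - U_(ti i))%MM = (diag_exp m - U_(ti i))%MM.
  by apply/mnmP => j; rewrite !(mnmBE, mulmnE, mnm1E) subn0 subnAC.
rewrite !(mnmBE, mnm1E) (inj_eq lift_inj) subn0.
(* For i = 0 and delta = n_1 > 0 the guard fails on the left, while on the right t_1 has exponent 0:
   both sides vanish. *)
by have [->|_] := eqVneq i ord0; do 4?[case: ifP => ? //]; lia.
Qed.

Lemma diagYM B :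
  ser_y k' * diag (fun m => ser_x ord0 * B m) =
  diag (fun m => ser_y k' * B (m - U_(ord0))%MM).
Proof.
apply/mpseriesP => m; rewrite mpsXM_coef !diagE !mpsXM_coef diag_expE diag_exp0.
rewrite !(mnmBE, mnm1E) /= subn0 mul1n.
have [m0|m0] := posnP (m ord0); first by rewrite if_same.
(* Lowering delta raises the exponent of t_1 by one; dividing by t_1 undoes this, leaving h
   lowered. *)
have -> : (diag_exp (m - U_(ord0)) - U_(ti ord0))%MM =
    (diag_exp m - U_(ord0))%MM.
  apply/mnmP => j; rewrite !(mnmBE, mulmnE, mnm1E) /=.
  by do 2!case: eqP => //=; lia.
by do 4?[case: ifP => ? //]; lia.
Qed.

End Diagonal.

(** * The series [P] and the identity H [1] = 1 *)

Section MasterTheorem.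
Variables (k' : nat) (omega : 'I_k'.+1 -> nat).
Local Notation k := k'.+1.
Local Notation N := k.+1.
Local Notation ti i := (lift ord0 i : 'I_N).
Implicit Types (P V : mpseries N int) (m : 'X_{1..N}) (i j : 'I_k).

Definition ser_U : mpseries N int :=
  1 + (\sum_j (omega j)%:R * ser_x j + ser_y k').

Lemma ser_U0 : ser_U 0%MM = 1.
Proof.
rewrite !mpsDE mps_sumE mps1E eqxx big1 => [|j _].
  by rewrite /= eq_sym mnm1_eq0 !addr0.
by rewrite mpsM0 ser_x0 mulr0.
Qed.

Definition Uprod m := \prod_i (ser_U - ser_x i) ^+ m (ti i).

Definition Udiag P := diag (fun m => P * Uprod m).

Fact Udiag_is_additive : zmod_morphism Udiag.
Proof.
move=> P Q; apply/mpseriesP => m; rewrite mpsBE !diagE.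
by case: ifP => _; rewrite ?subr0 // mulrBl mpsBE.
Qed.

HB.instance Definition _ := GRing.isZmodMorphism.Build _ _ Udiag
  Udiag_is_additive.

Lemma Uprod_subU i m : (0 < m (ti i))%N ->
  Uprod m = (ser_U - ser_x i) * Uprod (m - U_(ti i))%MM.
Proof.
move=> mi_gt0; rewrite /Uprod (bigD1 i) //= [in RHS](bigD1 i) //= mulrA.
rewrite -exprS mnmBE mnm1E eqxx subn1 prednK //; congr (_ * _).
apply: eq_bigr => j ji.
by rewrite mnmBE mnm1E (inj_eq lift_inj) eq_sym (negPf ji) subn0.
Qed.

(** The shift lowers n_i and so costs [Uprod] one factor U - t_i, which is supplied again next to
    P. *)
Lemma UdiagXM i P : Udiag (ser_x i * P) =
  ser_x i * Udiag ((ser_U - ser_x i) * P).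
Proof.
rewrite diagXM; apply/mpseriesP => m; rewrite !diagE; case: ifP => // _.
rewrite -[ser_x i * P * _]mulrA !mpsXM_coef; case: ifP => //.
rewrite diag_expE => mi_gt0; rewrite (Uprod_subU (i := i)) 1?mulrCA ?mulrA //.
by apply: leq_trans mi_gt0 (leq_subr _ _).
Qed.

Lemma UdiagYM P : Udiag (ser_y k' * P) = ser_y k' * Udiag (ser_x ord0 * P).
Proof.
have -> : Udiag (ser_x ord0 * P) = diag (fun m => ser_x ord0 * (P * Uprod m)).
  by apply/mpseriesP => m; rewrite !diagE mulrA.
rewrite diagYM; apply/mpseriesP => m; rewrite !diagE -mulrA.
(* [Uprod] does not depend on the exponent of y. *)
congr (if _ then mpscoeff (_ * (_ * _)) _ else _).
by apply: eq_bigr => i _; rewrite mnmBE mnm1E subn0.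
Qed.

Lemma UdiagXU i V : ser_U * V = 1 ->
  (1 + ser_x i) * Udiag (ser_x i * V) = ser_x i * Udiag 1.
Proof.
move=> UV; rewrite mulrDl mul1r {1}UdiagXM mulrBl UV raddfB /=; ring.
Qed.

Lemma ser_U_top i : mps_top 1 (ser_U - ser_x i) (ser_U - 1 - ser_x i).
Proof.
have lt_top : mps_lt 2 (ser_U - 1 - ser_x i).
  apply: mps_ltD; last exact/mps_ltN/mps_ltX.
  rewrite /ser_U [1 + _]addrC addrK; apply: mps_ltD; last exact: mps_ltX.
  elim/big_rec: _ => [|j f _ IH]; first exact: mps_lt0.
  by rewrite mulr_natl; apply: mps_ltD => //; apply/mps_ltMn/mps_ltX.
have diff1 : ser_U - ser_x i - (ser_U - 1 - ser_x i) = 1 by ring.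
split=> //; last by rewrite diff1; apply: mps_lt1.
have -> : ser_U - ser_x i = (ser_U - 1 - ser_x i) + 1 by ring.
by apply: mps_ltD => //; apply: mps_lt_le (@mps_lt1 _ _).
Qed.

Lemma Uprod_lt m : mps_lt (\sum_i m (ti i)).+1 (Uprod m).
Proof.
by case: (mps_top_prod (fun i => mps_topX (m (ti i)) (ser_U_top i))).
Qed.

Lemma Udiag_inv V : ser_U * V = 1 -> \prod_i (1 + ser_x i) * Udiag V = 1.
Proof.
move=> UV.
have kill i m : (0 < m (ti i))%N -> ((1 + ser_x i) * Udiag V) m = 0.
  move=> mi_gt0; rewrite mulrDl mul1r mpsDE diagXM !diagE.
  case: ifP => [le_m|_]; last by rewrite addr0.
  rewrite (Uprod_subU mi_gt0) -mpsDE; set A := Uprod _.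
  have -> : V * ((ser_U - ser_x i) * A) + ser_x i * (V * A) = ser_U * V * A.
    by ring.
  (* A has one factor fewer than [Uprod m], hence degree below that of [diag_exp m]. *)
  rewrite UV mul1r Uprod_lt // mdeg_diag_exp //.
  rewrite (bigD1 i) //= [X in (_ <= X)%N](bigD1 i) //= mnmBE mnm1E eqxx.
  rewrite -addSn subn1 prednK // leq_add2l; apply: leq_sum => j _.
  by rewrite mnmBE leq_subr.
have vanish_prod (Z : pred 'X_{1..N}) (p : pred 'I_k) (f : mpseries N int) :
    (forall i m, p i -> Z m -> Z (m - U_(ti i))%MM) ->
    (forall m, Z m -> f m = 0) ->
    forall m, Z m -> (\prod_(i | p i) (1 + ser_x i) * f) m = 0.
  move=> ZB f0; elim/big_rec: _ => [m|i g pi IH m].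
    by rewrite mul1r; apply: f0.
  by rewrite -mulrA; apply: mps_vanish_1DX IH m => m; apply: ZB.
apply/mpseriesP => m; rewrite mps1E; case: eqP => [->|/eqP m_neq0].
  rewrite mpsM0 diagE /diag_exp !mnm0E leqnn mulm0n subm0 mpsM0.
  have -> : Uprod 0%MM = 1 by apply: big1 => i _; rewrite mnm0E expr0.
  have -> : (\prod_(i < k) (1 + ser_x i)) 0%MM = 1.
    elim/big_ind: _ => [|f g f1 g1|i _].
    - by rewrite mps1E eqxx.
    - by rewrite mpsM0 f1 g1.
    - by rewrite mpsDE ser_x0 mps1E eqxx.
  have /mpseriesP/(_ 0%MM) := UV.
  by rewrite mpsM0 ser_U0 mps1E eqxx !mul1r mulr1.
have [i mi_gt0|m0] := pickP (fun i => 0 < m (ti i))%N.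
  (* The factors 1 + x_j with j != i leave n_i unchanged, so they preserve the vanishing where n_i >
     0. *)
  rewrite (bigD1 i isT) -mulrA mulrCA.
  apply: (vanish_prod (fun m => 0 < m (ti i))%N) => // [j m' ji|m'].
    by rewrite mnmBE mnm1E (inj_eq lift_inj) (negPf ji) subn0.
  exact: kill.
(* Here n = 0 and delta > 0. The region delta > n_1, where [diag] is 0 by default, is stable under
   lowering any n_i. *)
apply: (vanish_prod (fun m => m (ti ord0) < m ord0)%N) => // [i m'|m'|].
- by rewrite !mnmBE !mnm1E /= subn0 => _; apply: leq_ltn_trans (leq_subr _ _).
- by rewrite diagE ltnNge => /negPf->.
rewrite ltnNge; apply: contra m_neq0 => le_m0; apply/eqP/mnmP => j.
have mt0 i : m (ti i) = 0%N by apply/eqP; rewrite -leqn0 leqNgt m0.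
rewrite mnm0E; case: (unliftP ord0 j) => [i ->|->] //.
by apply/eqP; rewrite -leqn0 -(mt0 ord0).
Qed.

Lemma HserM_Udiag : Hser omega * Udiag 1 = 1.
Proof.
have U_unit : ser_U \is a GRing.unit.
  by rewrite mps_unitE ser_U0 unitr1.
pose V := ser_U^-1; have UV : ser_U * V = 1 by rewrite divrr.
have V_Udiag : Udiag 1 = Udiag V +
    (\sum_j (omega j)%:R * Udiag (ser_x j * V) +
      ser_y k' * Udiag (ser_x ord0 * V)).
  rewrite -{1}UV /ser_U mulrDl mul1r mulrDl mulr_suml !raddfD raddf_sum /=.
  rewrite UdiagYM; congr (_ + (_ + _)); apply: eq_bigr => j _.
  by rewrite -mulrA !mulr_natl raddfMn.
(* Hence H [1] is the full product of the 1 + x_i times [1] - sum_j omega_j [t_j V] - y [t_1 V],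
   which is [V]. *)
have splitX j : ser_x j * \prod_(i | i != j) (1 + ser_x i) * Udiag 1 =
    \prod_i (1 + ser_x i) * Udiag (ser_x j * V).
  by rewrite mulrAC -(UdiagXU _ UV) [in RHS](bigD1 j) //= mulrAC.
have sum_splitX :
    (\sum_j (omega j)%:R * ser_x j * \prod_(i | i != j) (1 + ser_x i)) *
      Udiag 1 =
    \prod_i (1 + ser_x i) * \sum_j (omega j)%:R * Udiag (ser_x j * V).
  rewrite mulr_suml mulr_sumr; apply: eq_bigr => j _.
  by rewrite -2![_%:R * _ * _]mulrA splitX mulrCA.
rewrite /Hser -[RHS](Udiag_inv UV).
have -> : Udiag V = Udiag 1 - \sum_j (omega j)%:R * Udiag (ser_x j * V) -
      ser_y k' * Udiag (ser_x ord0 * V) by rewrite {1}V_Udiag; ring.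
rewrite mulrBl sum_splitX mulrDl mulNr.
rewrite -2![ser_y k' * _ * _]mulrA splitX.
ring.
Qed.

Lemma Udiag1_top : Udiag 1 =
  diag (fun m => \prod_i (ser_U - 1 - ser_x i) ^+ m (ti i)).
Proof.
apply/mpseriesP => m; rewrite !diagE mul1r; case: ifP => // le_m.
apply: mps_top_coef; rewrite mdeg_diag_exp //.
by apply: mps_top_prod => i; apply/mps_topX/ser_U_top.
Qed.

(** * Geometric sums and the factors 1 - x_i *)

Let a i : mpseries N int := ser_U - 1 - ser_x i.

(** Here [a i] is t_hat_i + h, so for c = n_i this is the i-th factor in the definition of d. *)
Definition geom i c : mpseries N int :=
  \sum_(0 <= j < c) a i ^+ j * ser_x i ^+ (c - 1 - j).

Lemma geomS i c : geom i c.+1 = a i ^+ c + ser_x i * geom i c.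
Proof.
rewrite /geom big_nat_recr //= subn1 subnn mulr1 addrC mulr_sumr; congr (_ + _).
rewrite !big_nat; apply: eq_bigr => j /= lt_jc.
by rewrite mulrCA -exprS; congr (_ * _ ^+ _); lia.
Qed.

(* [r] lists the variables already divided by [1 - x_i]. *)
Definition geom_diag (r : seq 'I_k) := diag (fun m =>
  \prod_i (if i \in r then geom i (m (ti i)).+1 else a i ^+ m (ti i))).

(** Multiplication by x_i lowers n_i and inserts t_i, so [geomS] makes the difference collapse to
    the power of [a i]. *)
Lemma onemX_geom_diag i r : i \notin r ->
  (1 - ser_x i) * geom_diag (i :: r) = geom_diag r.
Proof.
move=> ir; rewrite mulrBl mul1r diagXM; apply/mpseriesP => m.
rewrite mpsBE !diagE; case: ifP => [_|]; last by rewrite subrr.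
have prodD1 (F : 'I_k -> mpseries N int) :
  \prod_j F j = F i * \prod_(j | j != i) F j by rewrite (bigD1 i).
rewrite prodD1 [in RHS]prodD1 mem_head (negPf ir).
rewrite geomS mulrDl mpsDE -!mulrA.
set rest := \prod_(j | _) _; set rest' := \prod_(j < k | j != i) _.
have <- : rest = rest' by apply: eq_bigr => j ji; rewrite inE (negPf ji).
rewrite -[RHS]addr0 -addrA; congr (_ + _).
apply/eqP; rewrite subr_eq0; apply/eqP.
(* If t_i has exponent 0, both sides vanish; otherwise n_i > 0 and (n_i - 1) + 1 = n_i. *)
rewrite !mpsXM_coef; case: ifP => // mi_gt0; congr (mpscoeff _ _).
rewrite [RHS]prodD1 mnmBE mnm1E eqxx subn1 mem_head prednK; last first.
  by apply: leq_trans mi_gt0 _; rewrite diag_expE leq_subr.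
congr (_ * _); apply: eq_bigr => j ji.
by rewrite mnmBE mnm1E (inj_eq lift_inj) eq_sym (negPf ji) subn0.
Qed.

Lemma prod_geom_diag r : uniq r ->
  \prod_(i <- r) (1 - ser_x i) * geom_diag r = Udiag 1.
Proof.
elim: r => [_|i r IHr /= /andP[ir r_uniq]].
  by rewrite big_nil mul1r Udiag1_top.
by rewrite big_cons mulrAC onemX_geom_diag // mulrC IHr.
Qed.

Lemma mps_of_t_factor c i : mps_of_mpoly (t_factor c omega i) = geom i (c i).
Proof.
rewrite rmorph_sum; apply: eq_bigr => j _.
rewrite rmorphM !rmorphXn /= mps_of_mpolyX; congr (_ ^+ _ * _).
rewrite /t_hat rmorphD rmorphB rmorph_sum /= !mps_of_mpolyX /a /ser_U.
rewrite [1 + _]addrC addrK addrAC; congr (_ + _ - _); apply: eq_bigr => l _.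
by rewrite rmorphM rmorph_nat /= mps_of_mpolyX.
Qed.

(** Removing x_1 ... x_k replaces each n_i by n_i - 1, which accounts for the exponents n_i - 1 in d
    and the successor in [geom_diag]. *)
Lemma dseriesE : dseries omega =
  \prod_i ser_x i * geom_diag (index_enum _).
Proof.
pose u : 'X_{1..N} := (\sum_i U_(ti i))%MM.
have uE j : u (ti j) = 1%N.
  rewrite mnm_sumE (bigD1 j) //= mnm1E eqxx big1 // => i ij.
  by rewrite mnm1E (inj_eq lift_inj) (negPf ij).
have u0 : u ord0 = 0%N by rewrite mnm_sumE big1 // => i _; rewrite mnm1E.
have -> : \prod_i ser_x i = mps_of_mpoly 'X_[u] :> mpseries N int.
  rewrite -mprodXE rmorph_prod; apply: eq_bigr => i _.
  by rewrite /= mps_of_mpolyX.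
apply/mpseriesP => m; rewrite mpsXmM_coef [LHS]/= /dcoef diagE.
rewrite !mnmBE u0 uE subn0.
have -> : (u <= m)%MM = (0 < m (ti ord0))%N &&
    [forall (i | i != ord0), 1 <= m (ti i)]%N.
  apply/mnm_lepP/andP => [le_um|[m1_gt0 /forall_inP m_gt0] j].
    split; first by rewrite -(uE ord0).
    by apply/forall_inP => i _; rewrite -(uE i).
  case: (unliftP ord0 j) => [i ->|->]; last by rewrite u0.
  by rewrite uE; case: (eqVneq i ord0) => [->|/m_gt0].
case: forall_inP => [m_gt0|_]; last by rewrite !andbF.
rewrite !andbT addn1.
(* The case n_1 = 0 is split off because the truncated guard delta <= n_1 - 1 would admit delta =
   0. *)
have [m1_gt0|m1_le0] := ltnP 0 (m (ti ord0)); last first.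
  by rewrite ifN // -ltnNge; apply: leq_ltn_trans m1_le0 _.
have -> : (m ord0 <= m (ti ord0) - 1)%N = (m ord0 < m (ti ord0))%N by lia.
case: ifP => // _.
have -> : dmonomial (fun i => m (ti i)) (m ord0) = diag_exp (m - u)%MM.
  apply/mnmP => j; rewrite /dmonomial mnmBE !mnmDE !mulmnE !mnmBE mnm_sumE u0.
  rewrite !mnm1E subn0; case: (unliftP ord0 j) => [i ->|->] /=; last first.
    rewrite u0 subn0 big1 => [|i _]; last by rewrite mulmnE mnm1E.
    lia.
  rewrite uE (inj_eq lift_inj).
  have [<-|ni0] := eqVneq ord0 i.
    rewrite big1 => [|l l0]; last first.
      by rewrite mulmnE mnm1E (inj_eq lift_inj) (negPf l0).
    lia.
  rewrite (bigD1 i) 1?eq_sym //= mulmnE mnm1E eqxx big1 => [|l /andP[_ li]].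
    lia.
  by rewrite mulmnE mnm1E (inj_eq lift_inj) (negPf li).
rewrite -[LHS]/(mps_of_mpoly _ _) rmorph_prod; congr (mpscoeff _ _).
apply: eq_bigr => i _; rewrite /= mps_of_t_factor mem_index_enum mnmBE uE.
rewrite subn1 prednK //.
by have [->//|/m_gt0] := eqVneq i ord0.
Qed.

End MasterTheorem.

Theorem theorem2 (k' : nat) (omega : 'I_k'.+1 -> nat) :
  dseries omega
  = 1 / Hser omega * \prod_(i : 'I_k'.+1) (ser_x i / (1 - ser_x i)).
Proof.
rewrite dseriesE mul1r big_split prodrV /= => [|i _].
2: by exact: onem_ser_x_unit.
rewrite mulrCA; congr (_ * _).
have den_unit : \prod_i (1 - ser_x i) \is a @GRing.unit (mpseries k'.+2 int).
  by apply: rpred_prod => i _; apply: onem_ser_x_unit.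
(* Clearing the denominators 1 - x_i leaves [1] = 1 / H. *)
apply: (mulIr den_unit); rewrite mulrVK // mulrC prod_geom_diag.
  by apply: (mulrI (Hser_unit omega)); rewrite HserM_Udiag divrr ?Hser_unit.
exact: index_enum_uniq.
Qed.
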